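(* Let $\mu$ be a singular cardinal. Then $\mathfrak{s}_\mu \leq \mathfrak{d}_\mu$.
   Context: Work in ZFC. Let $\kappa$ be the cofinality of $\mu$. $\kappa^\mu$ (as a set) denotes the set of functions from $\mu$ to $\kappa$. For $f,g\in\kappa^\mu$, $f$ dominates $g$ if $\{\alpha<\mu \mid f(\alpha)\le g(\alpha)\}$ has size less than $\mu$. A family $\mathcal{D}\subseteq\kappa^\mu$ is a dominating family if for every $f\in\kappa^\mu$ there is $g\in\mathcal{D}$ which dominates $f$. $\mathfrak{d}_\mu$ is the least cardinality of a dominating family $\mathcal{D}\subseteq\kappa^\mu$. $[\mu]^\mu$ is the set of subsets of $\mu$ of cardinality $\mu$. For $A,B\in[\mu]^\mu$, $A$ splits $B$ if $|B\cap A|=|B\setminus A|=\mu$. A family $\mathcal{S}\subseteq[\mu]^\mu$ is a splitting family if for every $B\in[\mu]^\mu$ there is $A\in\mathcal{S}$ which splits $B$. $\mathfrak{s}_\mu$ is the least cardinality of a splitting family $\mathcal{S}\subseteq[\mu]^\mu$. *)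

(* Defs.v *)
From HB Require Import structures.
From mathcomp Require Import all_boot all_order.
From mathcomp Require Import boolp classical_sets functions cardinality.

Set Implicit Arguments.
Unset Strict Implicit.
Unset Printing Implicit Defensive.

Import Order.TTheory.
Local Open Scope classical_set_scope.
Local Open Scope card_scope.
Local Open Scope order_scope.

(** An ordinal is represented by a well-founded totally ordered type, so that
    the smaller ordinals are, up to isomorphism, the proper initial segments
    [set b | b < a]. *)

Definition card_lt T U (A : set T) (B : set U) : Prop :=
  A #<= B /\ ~ (B #<= A).

Definition is_ordinal d (alpha : orderType d) : Prop :=
  well_founded (fun x y : alpha => x < y).

Definition is_cardinal d (mu : orderType d) : Prop :=
  is_ordinal mu /\
  forall a : mu, ~ ([set b : mu | b < a] #= [set: mu]).

(** The restriction of [f] to [A] has unbounded range in [mu]. *)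
Definition cofinal_on dk dm (kappa : orderType dk) (mu : orderType dm)
    (A : set kappa) (f : kappa -> mu) : Prop :=
  forall x : mu, exists2 a, A a & x <= f a.

(** [kappa] is the least ordinal admitting a cofinal map to [mu]. *)
Definition is_cofinality dk dm (kappa : orderType dk) (mu : orderType dm) :
    Prop :=
  [/\ is_ordinal kappa,
      exists f : kappa -> mu, cofinal_on [set: kappa] f &
      forall a : kappa,
        ~ exists f : kappa -> mu, cofinal_on [set b : kappa | b < a] f].

Section InitialSegment.
Variables (d : Order.disp_t) (mu : orderType d) (a : mu).
Definition segment := {b : mu | b < a}.
HB.instance Definition _ := SubChoice.on segment.
HB.instance Definition _ := [SubChoice_isSubOrder of segment by <: with d].
End InitialSegment.

Lemma cofinality_exists d (mu : orderType d) : is_ordinal mu ->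
  exists kappa : orderType d, is_cofinality kappa mu.
Proof.
move=> wf; pose cof (a : mu) :=
  exists f : mu -> mu, cofinal_on [set b : mu | b < a] f.
have [[a cofa]|ncof] := pselect (exists a, cof a); last first.
  exists mu; split=> //; last by move=> a cofa; apply: ncof; exists a.
  by exists id => x; exists x.
have {a cofa}[a [[f fcof] amin]] : exists a, cof a /\ forall b, b < a -> ~ cof b.
  elim/(well_founded_ind wf): a cofa => a IH cofa.
  have [[b [ba cofb]]|nb] := pselect (exists b, b < a /\ cof b); first exact: IH ba cofb.
  by exists a; split=> // b ba cofb; apply: nb; exists b.
exists (segment a : orderType d); split.
- have lift x : forall y : segment a, val y = x -> Acc (fun u v : segment a => u < v) y.
    elim/(well_founded_ind wf): x => x IH y yx; constructor=> z zy.
    by apply: (IH (val z)) => //; rewrite -yx.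
  by move=> y; exact: lift erefl.
- exists (fun b => f (val b)) => x.
  by have [b /= ba xfb] := fcof x; exists (exist _ b ba).
- move=> b [g gcof]; apply: (amin (val b) (valP b)).
  exists (fun c => if insub c is Some c' then g c' else c) => x.
  have [c /= cb xgc] := gcof x; exists (val c) => //.
  by rewrite valK.
Qed.

(** The last clause says that the cofinality of [mu] is not [mu] itself. *)
Definition is_singular d (mu : orderType d) : Prop :=
  [/\ is_cardinal mu, infinite_set [set: mu] & ~ is_cofinality mu mu].

(** A cardinal number defined as a minimum over families is represented by a
    family of least cardinality, so that such numbers are compared by [#<=];
    [least_cardP] shows that there is one. *)
Definition least_card T (P : set (set T)) : set T :=
  xget set0 [set D | P D /\ forall E, P E -> D #<= E].

Lemma least_cardP T (P : set (set T)) : P !=set0 ->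
  P (least_card P) /\ forall E, P E -> least_card P #<= E.
Proof.
move=> [D0 PD0]; rewrite /least_card.
suff: exists D, P D /\ forall E, P E -> D #<= E by exact: xgetPex.
have [[D [PD D_0]]|P_n0] := pselect (exists D, P D /\ D = set0).
  by exists D; split=> // E _; rewrite D_0 card_ge0.
have Pn0 E : P E -> E !=set0.
  by move=> PE; apply/set0P/negP => /eqP E0; apply: P_n0; exists E.
(* A maximal set of choice functions with injective evaluations
   must evaluate onto some member of [P]. *)
pose ok (C : set (set T -> T)) := forall E, P E ->
  (forall x, C x -> E (x E)) /\ (forall x y, C x -> C y -> x E = y E -> x = y).
have [F Fok totF|C [Cok Cmax]] := @Zorn_bigcup _ ok.
  move=> E PE; split=> [x [X FX Xx]|x y [X FX Xx] [Y FY Yy]].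
    by have [+ _] := Fok _ FX _ PE; apply.
  have [XY|YX] := totF _ _ FX FY.
    by have [_ +] := Fok _ FY _ PE; apply=> //; exact: XY.
  by have [_ +] := Fok _ FX _ PE; apply=> //; exact: YX.
have [D [PD DC]] : exists D, P D /\ forall t, D t -> exists2 x, C x & x D = t.
  apply: contrapT => noD.
  have miss E : exists t, P E -> E t /\ forall x, C x -> x E <> t.
    have [PE|nPE] := pselect (P E); last first.
      by have [t _] := Pn0 _ PD0; exists t => /nPE.
    apply: contrapT => nt; apply: noD; exists E; split=> // t Et.
    apply: contrapT => nx; apply: nt; exists t => _; split=> // x Cx xE.
    by apply: nx; exists x.
  have [x xP] := choice miss.
  apply: (Cmax (C `|` [set x])).
    split; first by left.
    move=> /(_ x (or_intror erefl)) Cx.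
    by have [_ /(_ x Cx)] := xP _ PD0.
  move=> E PE; have [Et xE] := xP _ PE; have [CE Cinj] := Cok _ PE.
  split=> [y [/CE//|->//]|y z [Cy|->] [Cz|->]] //; first exact: Cinj.
    by move=> /(xE _ Cy).
  by move=> /esym/(xE _ Cz).
exists D; split=> // E PE.
have CD : C #<= E.
  have [CE Cinj] := Cok _ PE.
  apply: card_le_trans (subset_card_le (A := (fun x => x E) @` C) _).
    have /card_eqPle[] // : (fun x => x E) @` C #= C.
    by apply: inj_card_eq => x y; rewrite !inE; exact: Cinj.
  by move=> _ [x /CE ? <-].
apply: card_le_trans CD.
apply: card_le_trans (card_image_le (fun x => x D) C).
by apply: subset_card_le => t /DC[x Cx <-]; exists x.
Qed.

Definition dominates d (mu : Type) (kappa : orderType d) (f g : mu -> kappa) :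
    Prop :=
  card_lt [set a : mu | f a <= g a] [set: mu].

Definition dominating_family d (mu : Type) (kappa : orderType d)
    (D : set (mu -> kappa)) : Prop :=
  forall f : mu -> kappa, exists2 g, D g & dominates g f.

Definition dominating_number d (mu : Type) (kappa : orderType d) :
    set (mu -> kappa) :=
  least_card [set D | dominating_family D].
Arguments dominating_number {d} mu kappa.

(** The set usually written [mu]^mu. *)
Definition full_subsets (mu : Type) : set (set mu) :=
  [set A | A #= [set: mu]].
Arguments full_subsets : clear implicits.

Definition splits (mu : Type) (A B : set mu) : Prop :=
  B `&` A #= [set: mu] /\ B `\` A #= [set: mu].

Definition splitting_family (mu : Type) (S : set (set mu)) : Prop :=
  S `<=` full_subsets mu /\
  forall B, full_subsets mu B -> exists2 A, S A & splits A B.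

Definition splitting_number (mu : Type) : set (set mu) :=
  least_card [set S | splitting_family S].
Arguments splitting_number : clear implicits.

(* Main.v *)
Require Import Defs.
From mathcomp Require Import all_boot all_order.
From mathcomp Require Import boolp classical_sets functions cardinality.
From mathcomp Require wochoice.

(** Every dominating family [D] of functions from [mu] to its cofinality
    [kappa] is turned into a splitting family with at most as many members, one
    set [A g] for each [g] in [D].

    Because [mu] is a limit cardinal, it splits into [kappa] consecutive blocks
    together with a strictly increasing cofinal sequence [s], such that the
    [j]-th block has more elements than [below (s j)] and all earlier blocks
    lie below [s j] ([block_decomposition]).  The blocks are the fibres of a
    map [b : mu -> kappa].  Two estimates, both instances of
    [card_le_sublevels], do the work.  (To have at least [s j] points means to
    be at least as large as [below (s j)].)

    - For [g : mu -> kappa], some [G j] in [kappa] is such that [g] is at most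
      [G j] on at least [s j] points of the [j]-th block.
    - For [B] of full size, some [h j] in [kappa] is such that [B] has at least
      [s j] points in the blocks with index from [j] to [h j].

    If [g] dominates [h \o b], then fewer than [mu] points [a] satisfy
    [g a <= h (b a)], which forces [h j < G j] for all large [j].  So [B] has
    at least [s j] points in the blocks with index from [j] to [G j], for all
    large [j].  Since [kappa] is regular, some set [C g] of indices, built from
    [G] alone, contains the interval from [j] to [G j] for cofinally many [j],
    and misses it for cofinally many other [j] ([alternating_intervals]).  The
    union [A g] of the blocks with index in [C g] then splits [B].

    That [mu] is a limit cardinal uses the idempotence of infinite cardinals
    under multiplication ([card_le_square]): otherwise [mu] would be a union of
    few sets, all of the size of one initial segment.  This idempotence comes
    from [card_le_sublevels] as well, applied to the maximum of two ordinals. *)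

Set Implicit Arguments.
Unset Strict Implicit.
Unset Printing Implicit Defensive.

Import Order.TTheory.
Local Open Scope order_scope.
Local Open Scope classical_set_scope.
Local Open Scope card_scope.

(** * Injections and cardinal comparison *)

Lemma card_le_injection T U (A : set T) (B : set U) (f : T -> U) :
    (forall x, A x -> B (f x)) ->
    (forall x y, A x -> A y -> f x = f y -> x = y) ->
  A #<= B.
Proof.
move=> AB finj; apply: (@card_le_trans _ _ _ (f @` A)).
  have /card_eqPle[] // : f @` A #= A.
  by apply: inj_card_eq => x y; rewrite !inE; exact: finj.
by apply: subset_card_le => _ [x /AB ? <-].
Qed.

(** The comparison [A #<= B] provides an injection between subtypes only; a
    point of [U] lets it extend to a total function. *)
Lemma injection_of_card_le T U (A : set T) (B : set U) : U -> A #<= B ->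
  exists f : T -> U, (forall x, A x -> B (f x)) /\
    (forall x y, A x -> A y -> f x = f y -> x = y).
Proof.
move=> u0 /card_leP[f].
pose h x := if pselect (A x) is left Ax then val (f (SigSub (mem_set Ax))) else u0.
exists h; split=> [x Ax|x y Ax Ay]; rewrite /h; case: pselect => // Ax'.
  exact: set_valP.
case: pselect => // Ay' /val_inj/(@inj _ _ _ f) e.
by have /(congr1 val) := e (mem_set I) (mem_set I).
Qed.

Lemma card_leX T1 T2 U1 U2 (A1 : set T1) (A2 : set T2) (B1 : set U1)
    (B2 : set U2) :
  U1 -> U2 -> A1 #<= B1 -> A2 #<= B2 -> A1 `*` A2 #<= B1 `*` B2.
Proof.
move=> u1 u2 /(injection_of_card_le u1)[f1 [AB1 inj1]].
move=> /(injection_of_card_le u2)[f2 [AB2 inj2]].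
apply: (@card_le_injection _ _ _ _ (fun p => (f1 p.1, f2 p.2))).
  by move=> [x y] [/= /AB1 ? /AB2 ?].
move=> [x y] [x' y'] [/= Ax Ay] [/= Ax' Ay'] [e1 e2].
by rewrite (inj1 _ _ Ax Ax' e1) (inj2 _ _ Ay Ay' e2).
Qed.

(** Hilbert's hotel: along a sequence of distinct points of [A], the new point
    takes the place of the first one and each of the others moves up by one. *)
Lemma infinite_card_leU1 T (A : set T) (c : T) :
  infinite_set A -> A `|` [set c] #<= A.
Proof.
move=> /infiniteP Ainf.
have [f [fA finj]] := injection_of_card_le c Ainf.
have {}finj m n : f m = f n -> m = n by exact: finj.
have [Ac|nAc] := pselect (A c).
  by apply: subset_card_le => x [//|->].
have fN n : f n <> c by move=> fc; apply: nAc; rewrite -fc; exact: fA.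
have hex x : exists y, [/\ forall n, f n = x -> y = f n.+1,
    x = c -> y = f 0%N & (forall n, f n <> x) -> x <> c -> y = x].
  have [[n <-]|nx] := pselect (exists n, f n = x).
    exists (f n.+1); split=> [m /finj->|/fN|/(_ n)] //.
  have {}nx n : f n <> x by move=> e; apply: nx; exists n.
  have [->|xc] := pselect (x = c); first by exists (f 0%N); split=> // n /fN.
  by exists x; split=> // n /nx.
have [h hP] := choice hex.
have cases x : (A `|` [set c]) x ->
    [\/ exists n, x = f n /\ h x = f n.+1, x = c /\ h x = f 0%N |
        [/\ A x, forall n, f n <> x & h x = x]].
  have [hf hc hid] := hP x.
  have [[n xn] _|nx] := pselect (exists n, x = f n).
    by apply: Or31; exists n; split=> //; exact: hf.
  case=> [Ax|xc]; last by apply: Or32; split=> //; exact: hc.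
  have {}nx n : f n <> x by move=> e; apply: nx; exists n.
  by apply: Or33; split=> //; apply: hid => // xc; apply: nAc; rewrite -xc.
apply: (@card_le_injection _ _ _ _ h).
  by move=> x /cases[[n [_ ->]]|[_ ->]|[? _ ->]] //; exact: fA.
move=> x y /cases[[m [xE ->]]|[xE ->]|[_ xn ->]]
           /cases[[n [yE ->]]|[yE ->]|[_ yn ->]] //.
- by rewrite xE yE => /finj[->].
- by move=> /finj.
- by move=> /yn.
- by move=> /finj.
- by rewrite xE yE.
- by move=> /yn.
- by move=> /esym/xn.
- by move=> /esym/xn.
Qed.

(** * Well-orders and cardinality *)

Lemma well_ordering T : exists R : T -> T -> Prop,
  well_founded R /\ forall x y, R x y \/ x = y \/ R y x.
Proof.
have [R Rwo] := wochoice.well_ordering_principle {classic T}.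
have Rwo' : wochoice.wo_chain R predT by move=> A _; exact: Rwo.
have Rtot x y : R x y || R y x by exact: (wochoice.wo_chainW Rwo').
have Ranti x y : R x y -> R y x -> x = y.
  move=> xy yx; apply: (wochoice.wo_chain_antisymmetric Rwo') => //.
  by rewrite xy.
exists (fun x y => R x y /\ x <> y); split=> [x|x y]; last first.
  have [->|xy] := pselect (x = y); first by right; left.
  by have /orP[] := Rtot x y; [left|right; right; split=> // yx; case: xy].
(* A least point outside the accessible part would be accessible. *)
apply: contrapT => nx.
have [|z [[/asboolP nz zmin] _]] :=
    Rwo [pred y : {classic T} | `[< ~ Acc (fun x y => R x y /\ x <> y) y >]].
  by exists x; apply/asboolP.
apply: nz; constructor=> y [yz neq]; apply: contrapT => ny.
by apply: neq; apply: Ranti => //; apply: zmin; apply/asboolP.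
Qed.

(** Transfinite recursion in which each value is only required to stand in a
    given relation to the earlier ones; that relation sees the earlier values
    alone, so solving it pointwise suffices. *)
Lemma well_founded_choice T U (R : T -> T -> Prop)
    (Q : forall x : T, (forall y, R y x -> U) -> U -> Prop) :
    well_founded R -> (forall x f, exists u, Q x f u) ->
  exists F : T -> U, forall x, Q x (fun y _ => F y) (F x).
Proof.
move=> Rwf Qex; pose step x f := projT1 (cid (Qex x f)).
exists (Fix Rwf (fun _ => U) step) => x.
rewrite (Fix_eq Rwf (fun _ => U) step) => [|y f g fg].
  exact: (projT2 (cid (Qex x _))).
by congr step; apply: functional_extensionality_dep => z;
   apply: functional_extensionality_dep => r.
Qed.

Lemma least_exists d (kappa : orderType d) (P : set kappa) :
  is_ordinal kappa -> P !=set0 ->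
  exists j, P j /\ forall i, P i -> j <= i.
Proof.
move=> wf [j]; elim/(well_founded_ind wf): j => j IH Pj.
have [[i [ij Pi]]|nP] := pselect (exists i, i < j /\ P i); first exact: IH ij Pi.
exists j; split=> // i Pi; rewrite leNgt; apply/negP => ij.
by apply: nP; exists i.
Qed.

(** Map the points of [X] one after the other to unused points of [L]: when a
    point [x] is reached, the points used so far are at most as many as the
    predecessors of [x], hence do not exhaust [L]. *)
Lemma card_le_initial_segments T U (R : T -> T -> Prop) (X : set T)
    (L : set U) :
    well_founded R -> (forall x y, R x y \/ x = y \/ R y x) ->
    (forall x, X x -> ~ (L #<= X `&` [set y | R y x])) ->
  X #<= L.
Proof.
move=> Rwf Rtri small.
have [->|/set0P[x0 Xx0]] := eqVneq X set0; first exact: card_ge0.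
have [u0 Lu0] : L !=set0.
  by apply/set0P/negP => /eqP L0; apply: (small _ Xx0); rewrite L0 card_ge0.
pose Q (x : T) (f : forall y, R y x -> U) (u : U) :=
  X x -> L u /\ forall y (r : R y x), X y -> f y r <> u.
have [|F FP] := @well_founded_choice _ _ _ Q Rwf.
  move=> x f; have [Xx|nXx] := pselect (X x); last by exists u0 => /nXx.
  apply: contrapT => full; apply: (small _ Xx).
  have hit u : exists y, L u -> exists r : R y x, X y /\ f y r = u.
    have [Lu|nLu] := pselect (L u); last by exists x0 => /nLu.
    apply: contrapT => nu; apply: full; exists u => _; split=> // y r Xy fyu.
    by apply: nu; exists y => _; exists r.
  have [h hP] := choice hit.
  apply: (@card_le_injection _ _ _ _ h) => [u /hP[r [Xy _]] //|u v Lu Lv uv].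
  have [r [_ <-]] := hP _ Lu; have [s [_ <-]] := hP _ Lv.
  by case: _ / uv s => s; congr f; exact: Prop_irrelevance.
apply: (@card_le_injection _ _ _ _ F) => [x /FP[]//|x y Xx Xy Fxy].
have [xy|[//|yx]] := Rtri x y.
  by have [_ /(_ x xy Xx)] := FP _ Xy.
by have [_ /(_ y yx Xy)] := FP _ Xx; rewrite Fxy.
Qed.

(** The union of an increasing chain of sets of size less than [L] has size at
    most [L], however long the chain.  Order [X] by the value of [g] first: the
    predecessors of [x] then lie in the sublevel set of [g] at [g x]. *)
Lemma card_le_sublevels T U d (kappa : orderType d) (g : T -> kappa)
    (X : set T) (L : set U) :
    is_ordinal kappa ->
    (forall x, X x -> ~ (L #<= X `&` [set y | g y <= g x])) ->
  X #<= L.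
Proof.
move=> wf small; have [R [Rwf Rtri]] := well_ordering T.
pose lex x y := g x < g y \/ g x = g y /\ R x y.
apply: (@card_le_initial_segments _ _ lex).
- move=> x; move: {2}(g x) (erefl (g x)) => c.
  elim/(well_founded_ind wf): c x => c IHc.
  elim/(well_founded_ind Rwf) => x IHx xc.
  constructor=> y [yx|[yx Ryx]]; last by apply: IHx => //; rewrite yx.
  by apply: (IHc (g y)) => //; rewrite -xc.
- move=> x y; rewrite /lex; have [xy|yx|xy] := ltgtP (g x) (g y).
  + by left; left.
  + by right; right; left.
  + have [?|[?|?]] := Rtri x y; [left|right; left|right; right] => //; by right.
- move=> x Xx Lx; apply: (small _ Xx); apply: card_le_trans Lx _.
  by apply: subset_card_le => y [Xy lyx]; split=> //=; case: lyx => [/ltW|[-> _]].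
Qed.

(** * Products and unions of infinite initial segments *)

Definition below d (mu : orderType d) (x : mu) : set mu := [set b | b < x].

Lemma below_subset d (mu : orderType d) (x y : mu) :
  x <= y -> below x `<=` below y.
Proof. by move=> xy b /lt_le_trans; exact. Qed.

(** The pairs from an initial cardinal [x], ordered by their maximum [c], have
    all their sublevel sets inside the square of the set of ordinals up to [c],
    whose size is less than [x] by induction. *)
Lemma card_le_square d (mu : orderType d) (x : mu) : is_ordinal mu ->
  infinite_set (below x) -> below x `*` below x #<= below x.
Proof.
move=> wf; elim/(well_founded_ind wf): x => x IH xinf.
(* Either [x] is as large as an earlier ordinal, or it is a cardinal. *)
have [[y [yx xy]]|xcard] := pselect (exists y, y < x /\ below x #<= below y).
  apply: card_le_trans (card_leX x x xy xy) _.
  apply: (@card_le_trans _ _ _ (below y)).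
    by apply: IH => // /(card_le_finite xy).
  exact/subset_card_le/below_subset/ltW.
apply: (@card_le_sublevels _ _ _ _ (fun p => Order.max p.1 p.2) _ _ wf).
move=> p [p1x p2x]; set c := Order.max p.1 p.2 => xc.
have cx : c < x by rewrite gt_max p1x.
have {xc} : below x #<= (below c `|` [set c]) `*` (below c `|` [set c]).
  apply: card_le_trans xc _; apply: subset_card_le => q [_ /=].
  rewrite ge_max => /andP[q1 q2]; split=> /=.
    by move: q1; rewrite le_eqVlt => /orP[/eqP|]; [right|left].
  by move: q2; rewrite le_eqVlt => /orP[/eqP|]; [right|left].
have [cfin|cinf] := pselect (finite_set (below c)).
  move=> /card_le_finite xfin; apply: xinf; apply: xfin.
  have cfin1 : finite_set (below c `|` [set c]).
    by rewrite finite_setU; split=> //; exact: finite_set1.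
  exact: finite_setX.
have c1 := infinite_card_leU1 c cinf.
move=> xc; apply: xcard; exists c; split=> //; apply: card_le_trans xc _.
exact: card_le_trans (card_leX c c c1 c1) (IH c cx cinf).
Qed.

(** A point of the union is coded by an index of a set that contains it and by
    its code in that set, both of them ordinals less than [x]. *)
Lemma card_le_bigcup I T d (mu : orderType d) (x : mu) (J : set I)
    (F : I -> set T) :
    is_ordinal mu -> infinite_set (below x) ->
    J #<= below x -> (forall i, J i -> F i #<= below x) ->
  \bigcup_(i in J) F i #<= below x.
Proof.
move=> wf xinf Jx Fx.
apply: card_le_trans (card_le_square wf xinf).
have [f [fJ finj]] := injection_of_card_le x Jx.
have Fxi i : exists h : T -> mu, J i -> (forall t, F i t -> below x (h t)) /\
    (forall t u, F i t -> F i u -> h t = h u -> t = u).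
  have [Ji|nJi] := pselect (J i); last by exists (fun _ => x) => /nJi.
  by have [h hP] := injection_of_card_le x (Fx _ Ji); exists h.
have [h hP] := choice Fxi.
have [->|/set0P[t0 [i0 Ji0 _]]] := eqVneq (\bigcup_(i in J) F i) set0.
  exact: card_ge0.
have idx t : exists i, (\bigcup_(i in J) F i) t -> J i /\ F i t.
  have [[i Ji Fi]|n] := pselect ((\bigcup_(i in J) F i) t); first by exists i.
  by exists i0 => /n.
have [i iP] := choice idx.
apply: (@card_le_injection _ _ _ _ (fun t => (f (i t), h (i t) t))).
  by move=> t /iP[Ji Fi]; split=> /=; [exact: fJ|have [+ _] := hP _ Ji; exact].
move=> t u /iP[Jt Ft] /iP[Ju Fu] [/finj e]; rewrite e //.
by have [_] := hP _ Ju; apply=> //; rewrite -e.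
Qed.

Lemma card_leU d (mu : orderType d) T (x : mu) (A B : set T) :
    is_ordinal mu -> infinite_set (below x) ->
    A #<= below x -> B #<= below x -> A `|` B #<= below x.
Proof.
move=> wf xinf Ax Bx.
have -> : A `|` B = \bigcup_(b in [set: bool]) (if b then A else B).
  apply/seteqP; split=> [t [At|Bt]|t [[] _ /=]]; [|by exists false| by left|by right].
  by exists true.
apply: card_le_bigcup => // [|[] _ //].
apply: card_le_trans ((infiniteP _).1 xinf).
by apply: (@card_le_injection _ _ _ _ nat_of_bool) => // -[] [].
Qed.

(** * Sequences indexed by a regular ordinal *)

Lemma cofinal_recursion d d' (kappa : orderType d) (tau : orderType d')
    (G : tau -> tau) (lo : kappa -> tau) :
    is_ordinal kappa ->
    (forall (j : kappa) (f : kappa -> tau), exists x, forall i, i < j -> f i < x) ->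
  exists s : kappa -> tau,
    forall j, lo j <= s j /\ forall i, i < j -> G (s i) < s j.
Proof.
move=> wf bounded.
pose Q (j : kappa) (f : forall i : kappa, i < j -> tau) (x : tau) :=
  lo j <= x /\ forall i (ij : i < j), G (f i ij) < x.
apply: (@well_founded_choice _ _ _ Q wf) => j f.
pose f' i := if pselect (i < j) is left ij then G (f i ij) else lo j.
have [x xP] := bounded j f'; exists (Order.max x (lo j)).
split=> [|i ij]; first by rewrite le_max lexx orbT.
rewrite lt_max; apply/orP; left; have := xP i ij; rewrite /f'.
by case: pselect => // ij'; rewrite (Prop_irrelevance ij ij').
Qed.

(** Choose disjoint intervals from [p i] to [G (p i)] and from [q (p i)] to
    [G (q (p i))] alternately, each one beginning after the end of all earlier
    ones, and let [C] be the union of the intervals of the first kind. *)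
Lemma alternating_intervals d (kappa : orderType d) (G : kappa -> kappa) :
    is_ordinal kappa -> (forall i : kappa, exists j, i < j) ->
    (forall (j : kappa) (f : kappa -> kappa),
      exists x, forall i, i < j -> f i < x) ->
  exists C : set kappa, forall i,
    (exists2 j, i <= j & [set k | j <= k <= G j] `<=` C) /\
    (exists2 j, i <= j & [set k | j <= k <= G j] `<=` ~` C).
Proof.
move=> wf nomax bounded.
have [q qP] := choice (fun j => nomax (Order.max j (G j))).
have [p pP] := cofinal_recursion (fun j => Order.max (G j) (G (q j))) id wf bounded.
have qgt j : j < q j by have := qP j; rewrite gt_max => /andP[].
have qgtG j : G j < q j by have := qP j; rewrite gt_max => /andP[].
have pgtG i j : i < j -> G (p i) < p j.
  by move=> /(proj2 (pP j)); rewrite gt_max => /andP[].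
have pgtGq i j : i < j -> G (q (p i)) < p j.
  by move=> /(proj2 (pP j)); rewrite gt_max => /andP[].
have ple j : j <= p j by have [] := pP j.
exists [set k | exists j, p j <= k <= G (p j)] => i; split.
  by exists (p i) => // k /= pk; exists i.
exists (q (p i)); first exact: le_trans (ple i) (ltW (qgt _)).
move=> k /= /andP[qk kG] [j /andP[pk kGp]].
have [ij|ji|ij] := ltgtP i j.
- by have := lt_le_trans (pgtGq _ _ ij) (le_trans pk kG); rewrite ltxx.
- have := le_lt_trans (le_trans qk kGp) (pgtG _ _ ji).
  by rewrite ltNge (ltW (qgt _)).
- by have := le_lt_trans (le_trans qk kGp) (qgtG (p j)); rewrite ij ltxx.
Qed.

(** * Singular cardinals are limit cardinals *)

Section SingularCardinal.
Variables (d : Order.disp_t) (mu : orderType d).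
Hypothesis mu_singular : is_singular mu.

Let wf_mu : is_ordinal mu. Proof. by have [[]] := mu_singular. Qed.

Lemma singular_not_le_below (x : mu) : ~ ([set: mu] #<= below x).
Proof.
have [[_ mu_card] _ _] := mu_singular.
move=> mux; apply: (mu_card x); rewrite card_eq_le; apply/andP; split=> //.
exact: card_leT.
Qed.

(** A greatest element could be removed without changing the cardinality,
    so that [mu] would be equinumerous with an initial segment. *)
Lemma singular_no_max (x : mu) : exists y, x < y.
Proof.
have [_ mu_inf _] := mu_singular.
apply: contrapT => nx.
have muE : [set: mu] `<=` below x `|` [set x].
  move=> y _; have [yx|xy|->] := ltgtP y x; [by left| |by right].
  by case: nx; exists y.
have [xfin|xinf] := pselect (finite_set (below x)).
  by apply: mu_inf; apply: sub_finite_set muE _; rewrite finite_setU; split.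
apply: (@singular_not_le_below x); apply: card_le_trans (subset_card_le muE) _.
exact: infinite_card_leU1.
Qed.

(** This is the form in which singularity is used: as [mu] is not its own
    cofinality, some cofinal map to [mu] is defined on an initial segment. *)
Lemma singular_union_of_few : exists (a : mu) (f : mu -> mu),
  [set: mu] `<=` \bigcup_(b in below a) below (f b).
Proof.
have [_ _ mu_ncof] := mu_singular.
have [[a [f fcof]]|na] := pselect (exists (a : mu) (f : mu -> mu),
    cofinal_on (below a) f).
  exists a, f => x _; have [y xy] := singular_no_max x; have [b ba yf] := fcof y.
  by exists b => //; exact: lt_le_trans yf.
case: mu_ncof; split=> //; first by exists id => x; exists x.
by move=> a af; apply: na; exists a.
Qed.

(** Otherwise [mu] would be a finite union of finite sets. *)
Lemma singular_infinite_below : exists x : mu, infinite_set (below x).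
Proof.
have [_ mu_inf _] := mu_singular.
have [a [f muE]] := singular_union_of_few.
apply: contrapT => nx; apply: mu_inf; apply: sub_finite_set muE _.
have fin (x : mu) : finite_set (below x) by apply: contrapT => xinf; apply: nx; exists x.
by apply: bigcup_finite.
Qed.

(** If [below x] were at least as large as each bounded set lying above it,
    then all initial segments would have at most its size, and so would their
    union [mu], since it suffices to take the union over an initial segment. *)
Lemma singular_limit (x : mu) : infinite_set (below x) ->
  exists y, ~ (below y `\` below x #<= below x).
Proof.
move=> xinf; have [a [f muE]] := singular_union_of_few.
apply: contrapT => ny.
have le_x (y : mu) : below y #<= below x.
  apply: (@card_le_trans _ _ _ (below x `|` (below y `\` below x))).
    by apply: subset_card_le => z zy; have [|] := pselect (below x z); [left|right].
  apply: card_leU => //; apply: contrapT => ynx; apply: ny; by exists y.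
apply: (@singular_not_le_below x); apply: card_le_trans (subset_card_le muE) _.
exact: card_le_bigcup.
Qed.

(** A set smaller than [mu] would be at most as large as some initial segment,
    hence smaller than another one. *)
Lemma full_subset_of_below T (A : set T) :
  (forall x : mu, below x #<= A) -> [set: mu] #<= A.
Proof.
move=> belowA.
apply: (@card_le_initial_segments _ _ (fun x y : mu => x < y)) => //.
  by move=> x y; have [|?|->] := ltgtP x y; [left|right; right|right; left].
move=> x _; rewrite setTI => Ax.
have [x0 x0inf] := singular_infinite_below; set z := Order.max x x0.
have zinf : infinite_set (below z).
  apply: sub_infinite_set x0inf; apply: below_subset.
  by rewrite le_max lexx orbT.
have [y] := singular_limit zinf; apply.
apply: card_le_trans (card_le_setD _ _) _.
apply: card_le_trans (belowA y) _; apply: card_le_trans Ax _.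
by apply/subset_card_le/below_subset; rewrite le_max lexx.
Qed.

(** * The decomposition into blocks *)

Section Blocks.
Variables (dk : Order.disp_t) (kappa : orderType dk).
Hypothesis kappa_cof : is_cofinality kappa mu.

Let wf_kappa : is_ordinal kappa. Proof. by have [] := kappa_cof. Qed.

Lemma cofinality_bounded (j : kappa) (f : kappa -> mu) :
  exists x, forall i, i < j -> f i < x.
Proof.
have [_ _ kappa_min] := kappa_cof.
apply: contrapT => nx; apply: (kappa_min j); exists f => x.
apply: contrapT => nf; apply: nx; exists x => i ij.
by rewrite ltNge; apply/negP => xf; apply: nf; exists i.
Qed.

(** By recursion, [s j] exceeds a bound [nx (s i)] for each [i < j], where the
    points from [s i] up to [nx (s i)] are more than [s i]; the block of [a] is
    the least [j] with [a < nx (s j)]. *)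
Lemma block_decomposition : exists (s : kappa -> mu) (b : mu -> kappa),
  [/\ forall i j, i < j -> s i < s j,
      forall x, exists j, x <= s j,
      forall j, infinite_set (below (s j)),
      forall j, ~ (b @^-1` [set j] #<= below (s j)) &
      forall j a, b a < j -> a < s j].
Proof.
have [x0 x0inf] := singular_infinite_below.
have [_ [e ecof] _] := kappa_cof.
have nxex (x : mu) : exists y, infinite_set (below x) ->
    ~ (below y `\` below x #<= below x).
  have [xinf|xfin] := pselect (infinite_set (below x)); last by exists x => /xfin.
  by have [y yP] := singular_limit xinf; exists y.
have [nx nxP] := choice nxex.
have [s sP] := cofinal_recursion nx (fun j => Order.max (e j) x0)
  wf_kappa cofinality_bounded.
have sinf j : infinite_set (below (s j)).
  apply: sub_infinite_set x0inf; apply: below_subset.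
  by have [+ _] := sP j; rewrite ge_max => /andP[].
have es j : e j <= s j by have [+ _] := sP j; rewrite ge_max => /andP[].
have s_nx j : s j < nx (s j).
  rewrite ltNge; apply/negP => nxs; apply: (nxP _ (sinf j)).
  by rewrite (_ : _ `\` _ = set0) ?card_ge0 // setD_eq0; exact: below_subset.
have nx_s i j : i < j -> nx (s i) < s j by have [_] := sP j; exact.
have scof x : exists j, x <= s j.
  by have [j _ xe] := ecof x; exists j; exact: le_trans (es j).
have bex (a : mu) : exists j, a < nx (s j) /\ forall i, a < nx (s i) -> j <= i.
  apply: (@least_exists _ _ [set j | a < nx (s j)] wf_kappa).
  by have [j aj] := scof a; exists j; exact: le_lt_trans (s_nx j).
have [b bP] := choice bex.
have bs j a : b a < j -> a < s j.
  by move=> /nx_s; apply: lt_trans; have [] := bP a.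
exists s, b; split=> // [i j /nx_s|j]; first exact: lt_trans.
(* These points escape the earlier blocks, which end below [s j]. *)
have fiber : below (nx (s j)) `\` below (s j) `<=` b @^-1` [set j].
  move=> a [anx /negP]; rewrite -leNgt => sa /=.
  apply: le_anti; have [_ ->//] := bP a; rewrite /= leNgt.
  by apply/negP => /bs; rewrite ltNge sa.
move=> /(card_le_trans (subset_card_le fiber)); exact: nxP.
Qed.

(** * From dominating to splitting *)

Lemma cofinality_no_max (i : kappa) : exists j, i < j.
Proof.
have [s [_ [s_incr s_cof _ _ _]]] := block_decomposition.
have [x sx] := singular_no_max (s i); have [j xj] := s_cof x; exists j.
rewrite ltNge; apply/negP; rewrite le_eqVlt => /orP[/eqP ji|/s_incr ji].
  by have := lt_le_trans sx xj; rewrite ji ltxx.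
by have := lt_trans (lt_le_trans sx xj) ji; rewrite ltxx.
Qed.

(** The cofinality is regular: if [f] were unbounded on an initial segment of
    [kappa], then [s \o f] would be cofinal in [mu] on that segment. *)
Lemma cofinality_regular (j : kappa) (f : kappa -> kappa) :
  exists x, forall i, i < j -> f i < x.
Proof.
have [s [_ [s_incr s_cof _ _ _]]] := block_decomposition.
have [x xP] := cofinality_bounded j (s \o f); have [k xk] := s_cof x; exists k => i ij.
have fk := lt_le_trans (xP i ij) xk.
rewrite ltNge; apply/negP; rewrite le_eqVlt => /orP[/eqP e|/s_incr kf].
  by move: fk; rewrite /= e ltxx.
by have := lt_trans fk kf; rewrite ltxx.
Qed.

(** The set [A g] is the union of the blocks with an index in [C g], where the
    latter contains, respectively misses, the interval from [j] to [G g j] for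
    cofinally many [j]; the function assigned to [B] is constant on blocks. *)
Lemma split_from_dominating : exists A : (mu -> kappa) -> set mu,
  forall B, full_subsets mu B ->
  exists f : mu -> kappa, forall g, dominates g f -> splits (A g) B.
Proof.
have [s [b [s_incr s_cof s_inf s_fiber b_lt]]] := block_decomposition.
have s_mono i j : i <= j -> s i <= s j.
  by rewrite le_eqVlt => /orP[/eqP->//|/s_incr/ltW].
have level (g : mu -> kappa) j : exists c,
    below (s j) #<= b @^-1` [set j] `&` [set a | g a <= c].
  apply: contrapT => nc; apply: (s_fiber j).
  apply: (@card_le_sublevels _ _ _ _ g _ _ wf_kappa) => a _ sa.
  by apply: nc; exists (g a).
have [G GP] : exists G : (mu -> kappa) -> kappa -> kappa, forall g j,
    below (s j) #<= b @^-1` [set j] `&` [set a | g a <= G g j].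
  have [G GP] := choice (fun gj : (mu -> kappa) * kappa => level gj.1 gj.2).
  by exists (fun g j => G (g, j)) => g j; exact: GP (g, j).
have [C CP] := choice (fun g =>
  alternating_intervals (G g) wf_kappa cofinality_no_max cofinality_regular).
exists (fun g => b @^-1` C g) => B B_full.
have B_ge : [set: mu] #<= B.
  by move: B_full; rewrite /full_subsets /= card_eq_le => /andP[].
(* Below block [j] there are only ordinals less than [s j], so most of [B]
   lies in the later blocks, which are an increasing union over [kappa]. *)
have next j : exists c,
    below (s j) #<= B `&` [set a | j <= b a <= c].
  apply: contrapT => nc; apply: (@singular_not_le_below (s j)).
  apply: card_le_trans B_ge _.
  apply: (@card_le_trans _ _ _ (below (s j) `|` (B `&` [set a | j <= b a]))).
    apply: subset_card_le => a Ba; have [?|/b_lt] := leP j (b a); last by left.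
    by right.
  apply: card_leU => //.
  apply: (@card_le_sublevels _ _ _ _ b _ _ wf_kappa) => a _ sa.
  apply: nc; exists (b a); apply: card_le_trans sa _.
  by apply: subset_card_le => c [[Bc /= jc] cb]; split=> //=; rewrite jc.
have [h hP] := choice next.
exists (h \o b) => g [_ Z_small].
(* The set where [g] fails to exceed [h \o b] is smaller than some segment. *)
have [x xP] : exists x : mu, ~ (below x #<= [set a | g a <= h (b a)]).
  apply: contrapT => nx; apply: Z_small; apply: full_subset_of_below => x.
  by apply: contrapT => xZ; apply: nx; exists x.
have h_lt j : x <= s j -> h j < G g j.
  move=> xj; rewrite ltNge; apply/negP => Gh; apply: xP.
  apply: card_le_trans (subset_card_le (below_subset xj)) _.
  apply: card_le_trans (GP g j) _; apply: subset_card_le => a [/= -> gG].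
  exact: le_trans Gh.
(* A set with all points of [B] in the blocks from [j] to [G g j], for
   cofinally many [j], has at least [s j] points for all large ones of them. *)
have full (D : set mu) :
    (forall i, exists2 j, i <= j & B `&` [set a | j <= b a <= G g j] `<=` D) ->
    D #= [set: mu].
  move=> DP; rewrite card_eq_le card_leT /=; apply: full_subset_of_below => y.
  have [i xyi] := s_cof (Order.max x y); have [j ij jD] := DP i.
  move: (le_trans xyi (s_mono _ _ ij)); rewrite ge_max => /andP[xj yj].
  apply: card_le_trans (subset_card_le (below_subset yj)) _.
  apply: card_le_trans (hP j) _; apply: subset_card_le => a [Ba /= /andP[ja ah]].
  by apply: jD; split=> //=; rewrite ja (le_trans ah) // ltW // h_lt.
split; apply: full => i; have [[j ij jC] [k ik kC]] := CP g i.
  by exists j => // a [Ba /jC].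
by exists k => // a [Ba /kC].
Qed.

End Blocks.
End SingularCardinal.

Theorem corollary4p4 (dm dk : Order.disp_t)
    (mu : orderType dm) (kappa : orderType dk)
    (mu_singular : is_singular mu) (kappa_cof : is_cofinality kappa mu) :
  splitting_number mu #<= dominating_number mu kappa.
Proof.
have [A AP] := split_from_dominating mu_singular kappa_cof.
have dom_ex : [set D | @dominating_family dk mu kappa D] !=set0.
  exists setT => /= f.
  have [g gP] := choice (fun a => cofinality_no_max mu_singular kappa_cof (f a)).
  exists g => //; rewrite /dominates (_ : [set _ | _] = set0).
    split; first exact: card_ge0.
    move=> /card_le_finite /(_ (finite_set0 _)).
    by have [] := mu_singular.
  by apply/seteqP; split=> a //=; rewrite leNgt gP.
have [/= D_dom _] := least_cardP dom_ex.
set D := least_card _ in D_dom.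
(* A splitting family consists of sets of full size, which [A g] need not be
   when it splits nothing. *)
pose S := (A @` D) `&` full_subsets mu.
have S_split : splitting_family S.
  split=> [_ []//|B /AP[f fP]]; have [g Dg /fP gB] := D_dom f.
  exists (A g) => //; split; first by exists g.
  rewrite /full_subsets /= card_eq_le card_leT /=.
  have [+ _] := gB; rewrite card_eq_le => /andP[_ /card_le_trans]; apply.
  by apply: subset_card_le => a [].
have split_ex : [set S | @splitting_family mu S] !=set0 by exists S.
have [_ S_min] := least_cardP split_ex.
apply: card_le_trans (S_min _ S_split) _.
apply: card_le_trans (card_image_le A D).
by apply: subset_card_le => C [].
Qed.
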